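(* Let $K$ be an algebraically closed field of characteristic $\ne2$, $G=\mathrm{PGL}_n(K)$, $n=2^st$ with $t$ odd and $s,t\ge1$. Let $1\le r\le s$, so $n=2^r\cdot 2^{s-r}t$, and let $D=D_r\times\bar U$ where $\bar U=\bar U_1\otimes I_{2^r}$ and $\bar U_1$ is either trivial or a toral elementary abelian $2$-subgroup of $\mathrm{PGL}_{2^{s-r}t}(K)$ with $C_{\mathrm{PGL}_{2^{s-r}t}(K)}(\bar U_1)$ connected. Then $$N_G(D)/C_G(D)\cong 2^{\mathrm{rk}\bar U\cdot r}:\big(\mathrm{GL}_r(2)\times W_{\mathrm{PGL}_{2^{s-r}t}(K)}(\bar U_1)\big),$$ a split extension of an elementary abelian group of order $2^{r\cdot\mathrm{rk}\bar U}$ by $\mathrm{GL}_r(2)\times W_{\mathrm{PGL}_{2^{s-r}t}(K)}(\bar U_1)$.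
   Context: $W_X(Y)=N_X(Y)/C_X(Y)$; $\mathrm{rk}$ is the rank of an elementary abelian group. Notation ($p=2$): for $0\le s'\le r-1$, $A_{s'}$ is the $2^r\times2^r$ diagonal matrix with $(A_{s'})_{ii}=(-1)^{\lfloor(i-1)/2^{s'}\rfloor}$ and $\bar A_{s'}$ its image (as $I_{n/2^r}\otimes A_{s'}$, block diagonal) in $\mathrm{PGL}_n(K)$; $D_r=\langle\bar A_0,\dots,\bar A_{r-1}\rangle$. $\bar U_1\otimes I_{2^r}$ is the image of $\{u\otimes I_{2^r}\}$ (Kronecker product replacing each entry by that scalar times $I_{2^r}$). Toral: contained in a maximal torus. *)

(* Defs.v *)
From HB Require Import structures.
From mathcomp Require Import all_boot all_order all_algebra all_fingroup all_solvable.
From mathcomp Require Import mxtens mpoly.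
From Stdlib Require Import ClassicalEpsilon.
Set Implicit Arguments. Unset Strict Implicit. Unset Printing Implicit Defensive.
Import GRing.Theory.
Local Open Scope ring_scope.

Definition pbool (P : Prop) : bool := if excluded_middle_informative P then true else false.

Section Defs.
Variable K : fieldType.

(** Projective equality: A and B have the same image in PGL (A = c B, c <> 0). *)
Definition pequiv n (A B : 'M[K]_n) : Prop := exists c : K, c != 0 /\ A = c *: B.

Definition mxprod n (l : seq 'M[K]_n) : 'M[K]_n := foldr mulmx 1%:M l.

Definition conjmx n (g A : 'M[K]_n) : 'M[K]_n := g *m A *m invmx g.

(** The 2^r x 2^r diagonal matrix A_{s'}: (A_{s'})_{ii} = (-1)^{floor((i-1)/2^{s'})}
    (1-based i), i.e. (-1)^(i %/ 2^{s'}) with 0-based i. *)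
Definition Amat (r s' : nat) : 'M[K]_(2 ^ r) :=
  \matrix_(i, j) ((i == j)%:R * (-1) ^+ (i %/ 2 ^ s')).

Definition Abar (m r s' : nat) : 'M[K]_(m * 2 ^ r) :=
  tensmx (1%:M : 'M[K]_m) (Amat r s').

Definition tensI (m r : nat) (u : 'M[K]_m) : 'M[K]_(m * 2 ^ r) :=
  tensmx u (1%:M : 'M[K]_(2 ^ r)).

(** A family u_0..u_{k-1} of matrices of GL_m whose images in PGL_m form a basis of
    an elementary abelian 2-subgroup of PGL_m (of rank k); the subgroup is the one they
    generate. *)
Definition eab_basis m k (u : 'I_k -> 'M[K]_m) : Prop :=
  [/\ forall i, u i \in unitmx,
      forall i, pequiv (u i *m u i) 1%:M,
      forall i j, pequiv (u i *m u j) (u j *m u i)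
    & forall S : {set 'I_k}, pequiv (mxprod [seq u i | i <- enum S]) 1%:M -> S = set0].

Definition eltU m k (u : 'I_k -> 'M[K]_m) (S : {set 'I_k}) : 'M[K]_m :=
  mxprod [seq u i | i <- enum S].

(** Toral: contained in a maximal torus, i.e. simultaneously conjugate (in PGL_m) into
    the image of the diagonal matrices. *)
Definition toral m k (u : 'I_k -> 'M[K]_m) : Prop :=
  exists P : 'M[K]_m, P \in unitmx /\ forall i, is_diag_mx (conjmx P (u i)).

(** Zariski topology on M_m(K) = K^(m*m) (GL_m carries the subspace topology). *)
Definition mxcoords m (A : 'M[K]_m) : 'I_(m * m) -> K := fun i => mxvec A 0 i.

Definition zariski_closed m (Z : 'M[K]_m -> Prop) : Prop :=
  exists F : {mpoly K[m * m]} -> Prop,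
    forall A, Z A <-> (forall p, F p -> p.@[mxcoords A] = 0).

Definition zariski_connected m (S : 'M[K]_m -> Prop) : Prop :=
  forall Z1 Z2 : 'M[K]_m -> Prop, zariski_closed Z1 -> zariski_closed Z2 ->
    (forall A, S A -> Z1 A \/ Z2 A) ->
    (forall A, S A -> Z1 A -> Z2 A -> False) ->
    (forall A, S A -> Z1 A) \/ (forall A, S A -> Z2 A).

Definition PGL_centralizer_preim m k (u : 'I_k -> 'M[K]_m) : 'M[K]_m -> Prop :=
  fun g => g \in unitmx /\ forall i, pequiv (conjmx g (u i)) (u i).

(** Weyl group W_{PGL_m}(U) = N(U)/C(U), realised faithfully as the group of permutations
    of U (indexed by {set 'I_k}) induced by conjugation. *)
Definition WeylU m k (u : 'I_k -> 'M[K]_m) : {set {perm {set 'I_k}}} :=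
  [set sigma : {perm {set 'I_k}} |
     pbool (exists g : 'M[K]_m, g \in unitmx /\
          forall S, pequiv (conjmx g (eltU u S)) (eltU u (sigma S)) )].

Definition eltD m r k (u : 'I_k -> 'M[K]_m) (x : {set 'I_r} * {set 'I_k})
  : 'M[K]_(m * 2 ^ r) :=
  mxprod [seq Abar m r (nat_of_ord i) | i : 'I_r <- enum x.1] *m mxprod [seq tensI r (u j) | j <- enum x.2].

(** Weyl group W_G(D) = N_G(D)/C_G(D), G = PGL_{m 2^r}(K), as permutations of D. *)
Definition WeylD m r k (u : 'I_k -> 'M[K]_m) : {set {perm ({set 'I_r} * {set 'I_k})}} :=
  [set sigma : {perm ({set 'I_r} * {set 'I_k})} |
     pbool (exists g : 'M[K]_(m * 2 ^ r), g \in unitmx /\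
          forall x, pequiv (conjmx g (eltD u x)) (eltD u (sigma x)) )].

End Defs.

(* Main.v *)
Require Import Defs.
From HB Require Import structures.
From mathcomp Require Import all_boot all_order all_algebra all_fingroup all_solvable.
From mathcomp Require Import mxtens mpoly.
From Stdlib Require ClassicalEpsilon.
Set Implicit Arguments. Unset Strict Implicit. Unset Printing Implicit Defensive.
Import GRing.Theory.
Local Open Scope ring_scope.

(** Scale the generators of [U_1] to commuting involutions [v_i] in [GL_m]; then
    [D] lifts to an elementary abelian group of matrices [v^b (x) A^a], with [(a, b)]
    in [F_2^r x F_2^k].
    - Realised automorphisms: [N_G(D)] induces [GL_r(2)] by permuting the coordinates
      of [K^(2^r)] linearly, [W(U_1)] by acting on [K^m], and every [(a, b) |-> (a, b + phi a)].
    - Nothing else: a matrix commuting with [D_r] is block diagonal with [2^r] blocks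
      from [GL_m].  Any [h] centralising [D] in [PGL] becomes such a matrix after
      multiplication by a translation of [F_2^r], so connectedness of the centraliser
      of [U_1] forces [h] to commute exactly with [U].  Elements of [D] outside
      [U] fail this for some translation, so normalising matrices preserve [U];
      restricting to one block then gives an element of [W(U_1)]. *)

(** * Subsets of a finite set as vectors over [F_2] *)

Section F2Vectors.

Lemma F2P (x : 'F_2) : x = 0 \/ x = 1.
Proof. by case: x => [[|[|]]] // i; [left | right]; apply: val_inj. Qed.

Lemma addF2xx n (a : 'rV['F_2]_n) : a + a = 0.
Proof. by apply/rowP => i; rewrite !mxE; case: (F2P (a 0 i)) => ->; apply: val_inj. Qed.

Definition vset n (S : {set 'I_n}) : 'rV['F_2]_n := \row_i (i \in S)%:R.
Definition setv n (a : 'rV['F_2]_n) : {set 'I_n} := [set i | a 0 i != 0].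

Lemma vsetK n : cancel (@vset n) (@setv n).
Proof. by move=> S; apply/setP => i; rewrite inE mxE; case: (i \in S). Qed.

Lemma setvK n : cancel (@setv n) (@vset n).
Proof. by move=> a; apply/rowP => i; rewrite mxE inE; case: (F2P (a 0 i)) => ->. Qed.

Lemma vset0 n : vset (set0 : {set 'I_n}) = 0.
Proof. by apply/rowP => i; rewrite !mxE inE. Qed.

Lemma vset_sum n (S : {set 'I_n}) : vset S = \sum_(i <- enum S) delta_mx 0 i.
Proof.
rewrite big_enum [LHS]row_sum_delta [RHS]big_mkcond /=; apply: eq_bigr => i _.
by rewrite mxE; case: (i \in S); rewrite ?scale1r ?scale0r.
Qed.

(** A nonzero vector has a coordinate equal to 1. The form [al] will name a translation of [F_2^r]
    whose sign detects [a]. *)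
Lemma exists_dual n (a : 'rV['F_2]_n) : a != 0 ->
  exists al : 'cV['F_2]_n, (a *m al) 0 0 = 1.
Proof.
case/rV0Pn => i ai; exists (delta_mx i 0); rewrite -colE mxE.
by case: (F2P (a 0 i)) ai => ->.
Qed.

(** Over [F_2] additive maps are linear, since the only scalars are 0 and 1. *)
Lemma additive_mx p q (f : 'rV['F_2]_p -> 'rV['F_2]_q) :
  {morph f : x y / x + y} -> exists M, forall a, f a = a *m M.
Proof.
move=> fD; have f0 : f 0 = 0 by apply: (addrI (f 0)); rewrite -fD !addr0.
exists (\matrix_i f (delta_mx 0 i)) => a.
rewrite {1}[a]row_sum_delta (big_morph f fD f0) mulmx_sum_row.
apply: eq_bigr => i _; rewrite rowK.
by case: (F2P (a 0 i)) => ->; rewrite ?scale1r ?scale0r.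
Qed.

End F2Vectors.

(** * Equality in [PGL] and the permutations induced by conjugation *)

Section ProjectiveEquality.
Variable K : fieldType.

Lemma pequiv_refl n (A : 'M[K]_n) : pequiv A A.
Proof. by exists 1; rewrite oner_neq0 scale1r. Qed.

Lemma pequiv_sym n (A B : 'M[K]_n) : pequiv A B -> pequiv B A.
Proof.
by case=> c [c0 ->]; exists c^-1; rewrite invr_eq0 c0 scalerA mulVf ?scale1r.
Qed.

Lemma pequiv_trans n (A B C : 'M[K]_n) : pequiv A B -> pequiv B C -> pequiv A C.
Proof.
by case=> c [c0 ->] [d [d0 ->]]; exists (c * d); rewrite mulf_neq0 // scalerA.
Qed.

Lemma pequiv_mul n (A B C D : 'M[K]_n) :
  pequiv A B -> pequiv C D -> pequiv (A *m C) (B *m D).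
Proof.
case=> c [c0 ->] [d [d0 ->]]; exists (c * d).
by rewrite mulf_neq0 // -scalemxAl -scalemxAr scalerA.
Qed.

Lemma mx_neq0 n (A : 'M[K]_n) : (0 < n)%N -> A \in unitmx -> A != 0.
Proof.
move=> n0 uA; apply/eqP => A0; move: (mulmxV uA); rewrite A0 mul0mx.
move/matrixP/(_ (Ordinal n0) (Ordinal n0)); rewrite !mxE eqxx => /eqP.
by rewrite eq_sym oner_eq0.
Qed.

Lemma scalemx_inj n (A : 'M[K]_n) c d :
  (0 < n)%N -> A \in unitmx -> c *: A = d *: A -> c = d.
Proof.
move=> n0 /(mx_neq0 n0) A0 /eqP.
by rewrite -subr_eq0 -scalerBl scaler_eq0 (negPf A0) orbF subr_eq0 => /eqP.
Qed.

(** Conjugation up to a scalar, written without inverses so that such relations can be multiplied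
    and rescaled directly. *)
Definition pconj n (g A B : 'M[K]_n) : Prop :=
  exists c : K, c != 0 /\ g *m A = c *: (B *m g).

Lemma pconjP n (g A B : 'M[K]_n) :
  g \in unitmx -> pequiv (Defs.conjmx g A) B <-> pconj g A B.
Proof.
move=> ug; split=> [[c [c0 e]]|[c [c0 e]]]; exists c; split=> //.
  by rewrite scalemxAl -e /Defs.conjmx mulmxKV.
by rewrite /Defs.conjmx e -scalemxAl mulmxK.
Qed.

Lemma pconj_equiv n (g A B A' B' : 'M[K]_n) :
  pequiv A A' -> pequiv B B' -> pconj g A B -> pconj g A' B'.
Proof.
case=> a [a0 ->] [b [b0 ->]] [c [c0 e]]; exists (a^-1 * c * b).
rewrite !mulf_neq0 ?invr_eq0 //; split=> //.
rewrite -scalemxAr -scalemxAl scalerA in e.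
by rewrite -mulrA -scalerA -e scalerA mulVf ?scale1r.
Qed.

(** Leaving the index type and the representatives [L] arbitrary lets the same facts serve [U], [D]
    and their forms indexed by subsets. *)
Definition induced n (X : Type) (L : X -> 'M[K]_n) (f : X -> X) : Prop :=
  exists g : 'M[K]_n, g \in unitmx /\ forall x, pconj g (L x) (L (f x)).

Lemma induced_ext n X (L : X -> 'M[K]_n) f f' :
  f =1 f' -> induced L f -> induced L f'.
Proof. by move=> e [g [ug h]]; exists g; split=> // x; rewrite -e. Qed.

Lemma induced_id n X (L : X -> 'M[K]_n) : induced L id.
Proof.
exists 1%:M; rewrite unitmx1; split=> // x; exists 1.
by rewrite oner_neq0 mul1mx mulmx1 scale1r.
Qed.

Lemma induced_comp n X (L : X -> 'M[K]_n) f f' :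
  induced L f -> induced L f' -> induced L (f' \o f).
Proof.
move=> [g [ug hg]] [g' [ug' hg']]; exists (g' *m g); rewrite unitmx_mul ug ug'.
split=> // x; case: (hg x) => c [c0 e]; case: (hg' (f x)) => d [d0 e'].
exists (c * d); rewrite mulf_neq0 //; split=> //.
by rewrite -mulmxA e -scalemxAr [in LHS]mulmxA e' -scalemxAl scalerA -mulmxA.
Qed.

Lemma induced_inv n X (L : X -> 'M[K]_n) f f' :
  cancel f' f -> induced L f -> induced L f'.
Proof.
move=> fK [g [ug h]]; exists (invmx g); rewrite unitmx_inv; split=> // x.
case: (h (f' x)); rewrite fK => c [c0 e]; exists c^-1; rewrite invr_eq0; split=> //.
apply: (can_inj (mulKmx ug)); rewrite mulKVmx // -scalemxAr mulmxA e -scalemxAl.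
by rewrite scalerA mulVf // scale1r mulmxK.
Qed.

Lemma induced_transport n (X Y : Type) (L : X -> 'M[K]_n) (p : Y -> X) (q : X -> Y) f :
  cancel p q -> cancel q p -> induced L f <-> induced (L \o p) (q \o f \o p).
Proof.
move=> pK qK; split=> [[g [ug h]]|[g [ug h]]]; exists g; split=> // x.
  by rewrite /= qK.
by have := h (q x); rewrite /= !qK.
Qed.

Lemma induced_equiv n X (L L' : X -> 'M[K]_n) f : (forall x, pequiv (L x) (L' x)) ->
  (exists g, g \in unitmx /\ forall x, pequiv (Defs.conjmx g (L x)) (L (f x)))
    <-> induced L' f.
Proof.
move=> e; split=> [[g [ug h]]|[g [ug h]]]; exists g; split=> // x.
  by apply: (pconj_equiv (e x) (e _)); apply/pconjP.
by apply/pconjP=> //; apply: (pconj_equiv (pequiv_sym (e x)) (pequiv_sym (e _))).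
Qed.

Lemma pboolP P : reflect P (pbool P).
Proof. by rewrite /pbool; case: ClassicalEpsilon.excluded_middle_informative => h; constructor. Qed.

Definition inducedG n (X : finType) (L : X -> 'M[K]_n) : {set {perm X}} :=
  [set sigma : {perm X} | pbool (induced L sigma)].

Lemma inducedG_group n (X : finType) (L : X -> 'M[K]_n) : group_set (inducedG L).
Proof.
apply/group_setP; split=> [|f f'].
  by rewrite inE; apply/pboolP/(induced_ext _ (induced_id L)) => x; rewrite perm1.
rewrite !inE => /pboolP h /pboolP h'; apply/pboolP.
by apply: (induced_ext _ (induced_comp h h')) => x; rewrite permM.
Qed.

(** Conjugation is multiplicative up to scalars, so [L (f (x + y))] and [L (f x + f y)] are
    proportional. As [X] has exponent 2, their product is [L] of the difference of the arguments and
    is scalar; freeness makes this difference vanish. *)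
Lemma induced_additive n (X : zmodType) (L : X -> 'M[K]_n) f :
    (forall x : X, x + x = 0) -> L 0 = 1%:M -> (forall x y : X, L (x + y) = L x *m L y) ->
    (forall x, pequiv (L x) 1%:M -> x = 0) ->
  induced L f -> forall x y : X, f (x + y) = f x + f y.
Proof.
move=> XX L0 LD Linj [g [ug h]] x y.
have oppX (z : X) : - z = z by apply: (addrI z); rewrite subrr XX.
apply: subr0_eq; rewrite oppX; apply: Linj.
case: (h x) (h y) (h (x + y)) => a [a0 ea] [b [b0 eb]] [c [c0 ec]].
have e : c *: L (f (x + y)) = (a * b) *: L (f x + f y).
  apply: (can_inj (mulmxK ug)); rewrite -!scalemxAl -ec LD mulmxA ea.
  by rewrite -scalemxAl -mulmxA eb -scalemxAr scalerA mulmxA LD.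
exists (c^-1 * (a * b)); rewrite !mulf_neq0 ?invr_eq0 //; split=> //.
rewrite LD -[L (f (x + y))](scalerK c0) e scalerA -scalemxAl -LD XX L0.
by [].
Qed.

(** Moving [g] past [A] twice produces the factor [c ^+ 2], while [A] and [B] have the same scalar
    square; hence [c ^+ 2 = 1]. *)
Lemma conj_scalar_sign n (g A B : 'M[K]_n) c e : (0 < n)%N -> g \in unitmx ->
    e != 0 -> A *m A = e *: 1%:M -> B *m B = e *: 1%:M ->
  g *m A = c *: (B *m g) -> c = 1 \/ c = -1.
Proof.
move=> n0 ug e0 AA BB h; apply/pred2P; rewrite -eqf_sqr expr1n; apply/eqP.
apply: (mulIf e0); apply: (scalemx_inj n0 ug); rewrite mul1r.
transitivity (g *m A *m A); last by rewrite -mulmxA AA -scalemxAr mulmx1.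
rewrite h -scalemxAl -mulmxA h -scalemxAr scalerA mulmxA BB -scalemxAl mul1mx.
by rewrite scalerA.
Qed.

End ProjectiveEquality.

(** * Diagonal sign matrices as characters of [F_2^r], and permutations of the basis *)

Lemma delta_mulmx n (i : 'I_n) (c : 'cV['F_2]_n) : ((delta_mx 0 i : 'rV_n) *m c) 0 0 = c i 0.
Proof. by rewrite -rowE mxE. Qed.

Section BitMatrices.
Variable K : fieldType.

Definition sg (x : 'F_2) : K := (-1) ^+ x.

Lemma sgD x y : sg (x + y) = sg x * sg y.
Proof.
by case: (F2P x) => ->; case: (F2P y) => ->;
  rewrite /sg /= ?mulr1 ?mul1r // -expr2 sqrrN expr1n.
Qed.

Lemma sgxx x : sg x * sg x = 1.
Proof. by rewrite /sg -expr2 sqrr_sign. Qed.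

Lemma sg_neq0 x : sg x != 0.
Proof. by rewrite signr_eq0. Qed.

Lemma odd_digits_inj r x y : (x < 2 ^ r)%N -> (y < 2 ^ r)%N ->
  (forall i, (i < r)%N -> odd (x %/ 2 ^ i) = odd (y %/ 2 ^ i)) -> x = y.
Proof.
elim: r x y => [|r IH] x y; first by rewrite expn0 !ltnS !leqn0 => /eqP-> /eqP->.
rewrite expnSr -!ltn_divLR // !divn2 => hx hy h.
rewrite -(odd_double_half x) -(odd_double_half y).
have := h 0 (ltn0Sn r); rewrite expn0 !divn1 => ->.
rewrite (IH _ _ hx hy) // => i ir.
by have := h i.+1 ir; rewrite expnS !divnMA !divn2.
Qed.

(** Binary digits, lowest first, identify the basis of [K^(2^r)] with [F_2^r]. *)
Definition bitv r (j : 'I_(2 ^ r)) : 'cV['F_2]_r := \col_i (odd (j %/ 2 ^ i))%:R.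

Lemma bitv_inj r : injective (@bitv r).
Proof.
move=> x y /matrixP e; apply/val_inj/(odd_digits_inj (ltn_ord x) (ltn_ord y)) => i ir.
have := e (Ordinal ir) 0; rewrite !mxE /=.
by case: (odd _); case: (odd _).
Qed.

Lemma bitv_bij r : bijective (@bitv r).
Proof.
by apply: (inj_card_bij (@bitv_inj r)); rewrite card_ord card_mx card_Fp // muln1.
Qed.

Lemma bitv_perm r (f : 'cV['F_2]_r -> 'cV['F_2]_r) : injective f ->
  exists s : {perm 'I_(2 ^ r)}, forall j, bitv (s j) = f (bitv j).
Proof.
move=> f_inj; case: (bitv_bij r) => g bK gK.
have inj : injective (g \o f \o @bitv r).
  exact: inj_comp (inj_comp (can_inj gK) f_inj) (can_inj bK).
by exists (perm inj) => j; rewrite permE /= gK.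
Qed.

Lemma addmx00 (R : nmodType) (A B : 'M[R]_1) : (A + B) 0 0 = A 0 0 + B 0 0.
Proof. by rewrite mxE. Qed.

(** The values of the character of [F_2^r] attached to [a], listed along the basis; the matrices
    [Amat] are the coordinate characters. *)
Definition Aw r (a : 'rV['F_2]_r) : 'M[K]_(2 ^ r) :=
  diag_mx (\row_j sg ((a *m bitv j) 0 0)).

Lemma Aw0 r : Aw (0 : 'rV_r) = 1%:M.
Proof.
rewrite -diag_const_mx; congr diag_mx; apply/rowP => j.
by rewrite mxE mul0mx !mxE.
Qed.

Lemma AwD r (a b : 'rV_r) : Aw (a + b) = Aw a *m Aw b.
Proof.
rewrite mulmx_diag; congr diag_mx; apply/rowP => j.
rewrite mxE mulmxDl addmx00 sgD. by rewrite [RHS]mxE; congr (_ * _); rewrite [RHS]mxE.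
Qed.

Lemma Aw_delta r (i : 'I_r) : Aw (delta_mx 0 i) = Amat K r i.
Proof.
apply/matrixP => j j'; rewrite [RHS]mxE [LHS]mxE [X in X *+ _]mxE delta_mulmx.
rewrite [bitv _ _ _]mxE mulr_natl -signr_odd; congr (_ *+ _).
by case: (odd _).
Qed.

Lemma perm_Aw r (s : {perm 'I_(2 ^ r)}) (a : 'rV_r) :
  perm_mx s *m Aw a = diag_mx (\row_j sg ((a *m bitv (s j)) 0 0)) *m perm_mx s.
Proof.
rewrite mul_mx_diag mul_diag_mx; apply/matrixP => i j; rewrite !mxE.
by case: eqP => [->|_]; rewrite ?mulr1 ?mul1r ?mulr0 ?mul0r.
Qed.

(** Permuting the basis by the linear map [M] on columns composes the character [a] with [M], which
    gives [a *m M]. *)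
Lemma exists_linear_perm r (M : 'M['F_2]_r) : M \in unitmx ->
  exists2 Q : 'M[K]_(2 ^ r), Q \in unitmx & forall a, Q *m Aw a = Aw (a *m M) *m Q.
Proof.
move=> uM; have [s hs] := bitv_perm (can_inj (@mulKmx _ _ 1 M uM)).
exists (perm_mx s); first exact: unitmx_perm.
move=> a; rewrite perm_Aw; set d := \row_j _.
suff -> : d = \row_j sg ((a *m M *m bitv j) 0 0) by [].
by apply/rowP => j; rewrite [LHS]mxE [RHS]mxE hs mulmxA.
Qed.

(** Translating the basis by [al] multiplies the character [a] by its value at [al]: the permutation
    centralises [D_r] projectively, but only up to signs. *)
Lemma exists_translation_perm r (al : 'cV['F_2]_r) : exists P : 'M[K]_(2 ^ r),
  P *m P = 1%:M /\ forall a, P *m Aw a = sg ((a *m al) 0 0) *: (Aw a *m P).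
Proof.
have [s hs] := bitv_perm (addIr al).
exists (perm_mx s); split=> [|a].
  rewrite -perm_mxM; have -> : (s * s)%g = 1%g; last exact: perm_mx1.
  apply/permP => j; rewrite permM perm1; apply: bitv_inj; rewrite !hs -addrA.
  by rewrite -[al]trmxK -raddfD addF2xx raddf0 addr0.
rewrite perm_Aw scalemxAl; congr (_ *m _); apply/matrixP => j j'.
rewrite [LHS]mxE [RHS]mxE [Aw a j j']mxE mulrnAr; congr (_ *+ _).
by rewrite [LHS]mxE hs mulmxDr addmx00 sgD mulrC; congr (_ * _); rewrite [RHS]mxE.
Qed.

End BitMatrices.

(** * Products of commuting involutions, Kronecker products and diagonal blocks *)

Section Blocks.
Variable K : fieldType.

Lemma mxprod_hom n q (L : 'rV['F_2]_q -> 'M[K]_n) (S : {set 'I_q}) :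
    L 0 = 1%:M -> (forall a b, L (a + b) = L a *m L b) ->
  mxprod [seq L (delta_mx 0 i) | i <- enum S] = L (vset S).
Proof.
move=> L0 LD; rewrite vset_sum; elim: (enum S) => [|i s IH] /=.
  by rewrite big_nil L0.
by rewrite big_cons LD -IH.
Qed.

Lemma mxprod_pequiv n (I : Type) (s : seq I) (f f' : I -> 'M[K]_n) :
    (forall i, pequiv (f i) (f' i)) ->
  pequiv (mxprod [seq f i | i <- s]) (mxprod [seq f' i | i <- s]).
Proof.
by move=> e; elim: s => [|i s IH] /=; [exact: pequiv_refl | exact: pequiv_mul].
Qed.

(** Exponents are residues modulo 2 read as 0 or 1; additivity in [b] therefore relies on the [v i]
    being commuting involutions. *)
Definition mxpow m k (v : 'I_k -> 'M[K]_m) (b : 'rV['F_2]_k) : 'M[K]_m :=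
  \prod_i v i ^+ b 0 i.

Lemma mxpow0 m k (v : 'I_k -> 'M[K]_m) : mxpow v 0 = 1%:M.
Proof. by rewrite /mxpow big1 // => i _; rewrite mxE expr0. Qed.

Lemma mxpow_delta m k (v : 'I_k -> 'M[K]_m) i : mxpow v (delta_mx 0 i) = v i.
Proof.
rewrite /mxpow (eq_bigr (fun j => if j == i then v j else 1)).
  by rewrite -big_mkcond big_pred1_eq.
by move=> j _; rewrite mxE eqxx /=; case: (j == i).
Qed.

Lemma mxpowD m k (v : 'I_k -> 'M[K]_m) b c :
    (forall i, v i *m v i = 1%:M) -> (forall i j, v i *m v j = v j *m v i) ->
  mxpow v (b + c) = mxpow v b *m mxpow v c.
Proof.
move=> vv vC; rewrite /mxpow.
have -> (x y : 'M[K]_m) : x *m y = x * y by [].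
rewrite -prodrM_comm => [|i j _ _]; last first.
  exact/commrX/commr_sym/commrX/vC.
apply: eq_bigr => i _; rewrite !mxE.
have vv' : v i * v i = 1 by exact: vv.
by case: (F2P (b 0 i)) => ->; case: (F2P (c 0 i)) => ->;
  rewrite /= ?expr0 ?expr1 ?mul1r ?mulr1.
Qed.

Variables m q : nat.

Lemma tensmx1 : (1%:M : 'M[K]_m) *t (1%:M : 'M[K]_q) = 1%:M.
Proof.
apply/matrixP => i j; case: (mxtens_indexP i) => {}i i'; case: (mxtens_indexP j) => {}j j'.
by rewrite tensmxE !mxE (can_eq (@mxtens_indexK _ _)) xpair_eqE -natrM mulnb.
Qed.

Lemma tensmxDl (A B : 'M[K]_m) (C : 'M[K]_q) : (A + B) *t C = A *t C + B *t C.
Proof.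
by apply/matrixP => i j; case: (mxtens_indexP i) => {}i i'; case: (mxtens_indexP j) => {}j j';
  rewrite [RHS]mxE !tensmxE mxE mulrDl.
Qed.

Lemma tensmxZl c (A : 'M[K]_m) (C : 'M[K]_q) : (c *: A) *t C = c *: (A *t C).
Proof.
by apply/matrixP => i j; case: (mxtens_indexP i) => {}i i'; case: (mxtens_indexP j) => {}j j';
  rewrite [RHS]mxE !tensmxE mxE mulrA.
Qed.

Lemma tensmxZr c (A : 'M[K]_m) (C : 'M[K]_q) : A *t (c *: C) = c *: (A *t C).
Proof.
by apply/matrixP => i j; case: (mxtens_indexP i) => {}i i'; case: (mxtens_indexP j) => {}j j';
  rewrite [RHS]mxE !tensmxE mxE mulrCA.
Qed.

Lemma tens_scalar_diag d : (1%:M : 'M[K]_m) *t diag_mx d =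
  diag_mx (\row_(l < m * q) d 0 (mxtens_unindex l).2).
Proof.
apply/matrixP => i j; case: (mxtens_indexP i) => {}i i'; case: (mxtens_indexP j) => {}j j'.
rewrite tensmxE !mxE mxtens_indexK /= (can_eq (@mxtens_indexK _ _)) xpair_eqE.
by case: (i == j); case: (i' == j'); rewrite /= ?mul1r ?mul0r.
Qed.

(** A matrix of size [m * q] is read as a [q] by [q] array of blocks of size [m], the second tensor
    index numbering the blocks. *)
Definition block (j0 : 'I_q) (g : 'M[K]_(m * q)) : 'M[K]_m :=
  \matrix_(i, i') g (mxtens_index (i, j0)) (mxtens_index (i', j0)).

Lemma block_tens j0 A B : block j0 (A *t B) = B j0 j0 *: A.
Proof. by apply/matrixP => i j; rewrite !mxE !mxtens_indexK mulrC. Qed.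

Lemma blockZ j0 c g : block j0 (c *: g) = c *: block j0 g.
Proof. by apply/matrixP => i j; rewrite !mxE. Qed.

Definition block_diagonal (g : 'M[K]_(m * q)) : Prop :=
  forall i j i' j', j != j' -> g (mxtens_index (i, j)) (mxtens_index (i', j')) = 0.

(** Block diagonality of the left factor suffices: in block row [j0] only the diagonal block of [g]
    contributes. *)
Lemma block_mul j0 g h :
  block_diagonal g -> block j0 (g *m h) = block j0 g *m block j0 h.
Proof.
move=> bg; apply/matrixP => i i'; rewrite !mxE.
rewrite (reindex (@mxtens_index m q)) /=; last first.
  by exists (@mxtens_unindex m q) => x _; rewrite ?mxtens_indexK ?mxtens_unindexK.
transitivity (\sum_l \sum_j g (mxtens_index (i, j0)) (mxtens_index (l, j)) *
                h (mxtens_index (l, j)) (mxtens_index (i', j0))).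
  by rewrite pair_bigA; apply: eq_bigr => -[].
apply: eq_bigr => l _; rewrite (bigD1 j0) //= big1 ?addr0 ?mxE // => j jj0.
by rewrite bg ?mul0r // eq_sym.
Qed.

(** Commutation at an entry in blocks [j], [j'] multiplies it by the difference of two diagonal
    values, nonzero for some [i] when [j != j']. *)
Lemma comm_diag_block_diagonal (I : Type) (d : I -> 'rV[K]_q) g :
    (forall j j', j != j' -> exists i, d i 0 j != d i 0 j') ->
    (forall i, g *m (1%:M *t diag_mx (d i)) = (1%:M *t diag_mx (d i)) *m g) ->
  block_diagonal g.
Proof.
move=> sep gC i j i' j' /sep[l dl]; apply/eqP.
have := gC l; rewrite tens_scalar_diag mul_mx_diag mul_diag_mx.
move=> /matrixP/(_ (mxtens_index (i, j)) (mxtens_index (i', j'))).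
rewrite !mxE !mxtens_indexK /= mulrC => /eqP.
by rewrite -subr_eq0 -mulrBl mulf_eq0 subr_eq0 eq_sym (negPf dl).
Qed.

End Blocks.

(** * Connectedness turns projective commutation into exact commutation *)

Section Rigidity.
Variables (K : fieldType) (m k : nat).

(** Each entry of [g *m B - C *m g] is a linear polynomial in the coordinates of [g]. *)
Lemma mulmx_eq_zariski_closed (B C : 'M[K]_m) :
  zariski_closed (fun g => g *m B = C *m g).
Proof.
pose pol i j : {mpoly K[m * m]} :=
  \sum_l ((B l j)%:MP * 'X_(mxvec_index i l)) -
  \sum_l ((C i l)%:MP * 'X_(mxvec_index l j)).
have polE A i j : (pol i j).@[mxcoords A] = (A *m B) i j - (C *m A) i j.
  rewrite mevalB !rmorph_sum !mxE; congr (_ - _); apply: eq_bigr => l _ /=.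
    by rewrite mevalM mevalC mevalXU /mxcoords mxvecE mulrC.
  by rewrite mevalM mevalC mevalXU /mxcoords mxvecE.
exists (fun p => exists i j, p = pol i j) => A; split=> [e _ [i [j ->]]|h].
  by rewrite polE e subrr.
apply/matrixP => i j; apply/eqP; rewrite -subr_eq0 -polE; apply/eqP/h.
by exists i, j.
Qed.

(** Since [u i] has scalar square, an element of the centraliser either commutes or anticommutes
    with it. These are two disjoint closed conditions covering a connected set, and the identity
    satisfies the first. *)
Lemma connected_centralizer_comm (u : 'I_k -> 'M[K]_m) :
    (0 < m)%N -> 2%:R != 0 :> K -> eab_basis u ->
    zariski_connected (PGL_centralizer_preim u) ->
  forall g, PGL_centralizer_preim u g -> forall i, g *m u i = u i *m g.
Proof.
move=> m0 two [uu u2 _ _] conn g Sg i.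
have [] := conn _ _ (mulmx_eq_zariski_closed (u i) (u i))
                    (mulmx_eq_zariski_closed (u i) (- u i)).
- move=> A [uA /(_ i)/(pconjP _ _ uA) [c [c0 e]]].
  case: (u2 i) => d [d0 ed].
  have [c1|c1] := conj_scalar_sign m0 uA d0 ed ed e.
    by left; rewrite e c1 scale1r.
  by right; rewrite e c1 scaleN1r mulNmx.
(* Both conditions at once would give twice an invertible matrix equal to 0. *)
- move=> A [uA _] -> /eqP; rewrite mulNmx -subr_eq0 opprK -mulr2n -scaler_nat.
  by rewrite scaler_eq0 (negPf two) /=; apply/negP/mx_neq0; rewrite // unitmx_mul uu.
- exact.
(* The identity does not anticommute with [u i], so the second alternative is impossible. *)
- move/(_ 1%:M) => h.
  have /h : PGL_centralizer_preim u 1%:M.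
    split=> [|j]; first exact: unitmx1.
    by rewrite /Defs.conjmx invmx1 mul1mx mulmx1; apply: pequiv_refl.
  rewrite mul1mx mulmx1 => /eqP; rewrite -subr_eq0 opprK -mulr2n -scaler_nat.
  by rewrite scaler_eq0 (negPf two) /= (negPf (mx_neq0 m0 (uu i))).
Qed.

End Rigidity.

(** * Which automorphisms of the lifted group are induced by conjugation *)

Section Automorphisms.
Variables (K : fieldType) (m k r : nat) (v : 'I_k -> 'M[K]_m).
Hypothesis two_neq0 : 2%:R != 0 :> K.
Hypothesis m_gt0 : (0 < m)%N.
Hypothesis vv : forall i, v i *m v i = 1%:M.
Hypothesis vC : forall i j, v i *m v j = v j *m v i.
Hypothesis v_free : forall b, pequiv (mxpow v b) 1%:M -> b = 0.
(** The form in which connectedness of the centraliser of [U_1] enters. *)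
Hypothesis v_rigid : forall g, g \in unitmx ->
  (forall i, pconj g (v i) (v i)) -> forall i, g *m v i = v i *m g.

Notation U := (mxpow v).
Notation V := ('rV['F_2]_r * 'rV['F_2]_k)%type.

Definition Dlift (x : V) : 'M[K]_(m * 2 ^ r) := U x.2 *t Aw K x.1.

Let UD b c : U (b + c) = U b *m U c. Proof. exact: mxpowD. Qed.

Lemma U_mulC b c : U b *m U c = U c *m U b.
Proof. by rewrite -!UD addrC. Qed.

Lemma Uxx b : U b *m U b = 1%:M.
Proof. by rewrite -UD addF2xx mxpow0. Qed.

Lemma Dlift0 : Dlift 0 = 1%:M.
Proof. by rewrite /Dlift mxpow0 Aw0 tensmx1. Qed.

Lemma DliftD x y : Dlift (x + y) = Dlift x *m Dlift y.
Proof. by rewrite /Dlift tensmx_mul -UD -AwD. Qed.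

Lemma V_addxx (x : V) : x + x = 0.
Proof. by case: x => a b; congr (_, _); apply: addF2xx. Qed.

Lemma Dliftxx x : Dlift x *m Dlift x = 1%:M.
Proof. by rewrite -DliftD V_addxx Dlift0. Qed.

Lemma Dlift_mulC x y : Dlift x *m Dlift y = Dlift y *m Dlift x.
Proof. by rewrite -!DliftD addrC. Qed.

Lemma dim_gt0 : (0 < m * 2 ^ r)%N.
Proof. by rewrite muln_gt0 m_gt0 expn_gt0. Qed.

Lemma one_neqN1 : 1 != -1 :> K.
Proof. by rewrite -subr_eq0 opprK. Qed.

Lemma sg_inj : injective (sg K).
Proof.
move=> x y; case: (F2P x) => ->; case: (F2P y) => -> //;
  rewrite /sg expr0 expr1 => /eqP; rewrite ?(negPf one_neqN1) //.
by rewrite eq_sym (negPf one_neqN1).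
Qed.

Lemma exists_translation (al : 'cV['F_2]_r) : exists T : 'M[K]_(m * 2 ^ r),
  T \in unitmx /\ forall x, T *m Dlift x = sg K ((x.1 *m al) 0 0) *: (Dlift x *m T).
Proof.
have [P [PP hP]] := exists_translation_perm K al.
exists (1%:M *t P); split.
  suff /mulmx1_unit[] : (1%:M : 'M_m) *t P *m (1%:M *t P) = 1%:M by [].
  by rewrite tensmx_mul mul1mx PP tensmx1.
by move=> x; rewrite /Dlift !tensmx_mul hP mul1mx mulmx1 tensmxZr.
Qed.

Definition ord_first : 'I_(2 ^ r) := Ordinal (expn_gt0 2 r).

Lemma block_Dlift b : block ord_first (Dlift (0, b)) = U b.
Proof. by rewrite /Dlift Aw0 block_tens mxE eqxx scale1r. Qed.

Lemma block_one : block ord_first (1%:M : 'M[K]_(m * 2 ^ r)) = 1%:M.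
Proof. by rewrite -Dlift0 block_Dlift mxpow0. Qed.

(** If [a != 0], some translation negates the lift, which is impossible for a nonzero scalar matrix;
    if [a = 0], one diagonal block reduces the claim to [U]. *)
Lemma Dlift_free x : pequiv (Dlift x) 1%:M -> x = 0.
Proof.
case: x => a b [c [c0 e]].
have [a0|] := eqVneq a 0.
  rewrite a0 in e *; congr (_, _); apply: v_free; exists c; split=> //.
  by rewrite -block_Dlift e blockZ block_one.
case/exists_dual => al h; have [T [uT hT]] := exists_translation al.
have := hT (a, b); rewrite e /= h -scalemxAr -scalemxAl mulmx1 mul1mx scalerA.
move/(scalemx_inj dim_gt0 uT)/eqP.
by rewrite -subr_eq0 -{1}[c]mul1r -mulrBl mulf_eq0 (negPf c0) subr_eq0 orbF
  (negPf one_neqN1).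
Qed.

Lemma induced_Dlift_additive f : induced Dlift f -> forall x y, f (x + y) = f x + f y.
Proof. exact: (induced_additive V_addxx Dlift0 DliftD Dlift_free). Qed.

Lemma induced_U_additive f : induced U f -> forall x y, f (x + y) = f x + f y.
Proof. exact: (induced_additive (@addF2xx k) (mxpow0 v) UD v_free). Qed.

(* [(1 + w) (x) 1 + (1 - w) (x) P] applies the translation [P] on the
   [-1]-eigenspace of the involution [w] only. *)
Lemma induced_elementary (al : 'cV['F_2]_r) (c : 'rV['F_2]_k) :
  induced Dlift (fun x => (x.1, x.2 + x.1 *m (al *m c))).
Proof.
have [P [PP hP]] := exists_translation_perm K al.
pose w := U c; pose g : 'M[K]_(m * 2 ^ r) := (1%:M + w) *t 1%:M + (1%:M - w) *t P.
have ww : w *m w = 1%:M by exact: Uxx.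
have wD : w *m (1%:M + w) = 1%:M + w by rewrite mulmxDr ww mulmx1 addrC.
have wB : w *m (1%:M - w) = - (1%:M - w) by rewrite mulmxBr ww mulmx1 opprB.
have DB : (1%:M + w) + (1%:M - w) = 1%:M *+ 2 by rewrite addrACA subrr addr0.
exists g; split.
  (* The cross terms vanish because [(1 + w)(1 - w) = 0], and the squares [2(1 + w)] and [2(1 - w)]
     add up to 4; so [g] is invertible. *)
  have gg : g *m g = 4%:R *: 1%:M.
    rewrite /g mulmxDl !mulmxDr !tensmx_mul PP !mulmx1 mul1mx.
    rewrite [(1%:M + w) *m (1%:M + w)]mulmxDl [(1%:M + w) *m (1%:M - w)]mulmxDl.
    rewrite [(1%:M - w) *m (1%:M + w)]mulmxBl [(1%:M - w) *m (1%:M - w)]mulmxBl.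
    rewrite !mul1mx wD wB opprK !subrr !tens0mx addr0 add0r -tensmxDl addrACA.
    by rewrite DB -mulrnDr -scaler_nat tensmxZl tensmx1.
  have four : 4%:R != 0 :> K by rewrite (natrM K 2 2) mulf_neq0.
  suff /mulmx1_unit[] : g *m (4%:R^-1 *: g) = 1%:M by [].
  by rewrite -scalemxAr gg scalerA mulVf // scale1r.
move=> [a b] /=; exists 1; rewrite oner_neq0 scale1r; split=> //.
rewrite mulmxA [a *m al]mx11_scalar mul_scalar_mx.
have wb : w *m U b = U b *m w by exact: U_mulC.
have comD : (1%:M + w) *m U b = U b *m (1%:M + w).
  by rewrite mulmxDl mulmxDr mul1mx mulmx1 wb.
have comB : (1%:M - w) *m U b = U b *m (1%:M - w).
  by rewrite mulmxBl mulmxBr mul1mx mulmx1 wb.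
(* If [a *m al] is 0, [P] commutes with [Aw a] and nothing changes. If it is 1, [P] contributes a
   sign on the [1 - w] term only, which is exactly multiplication by [w = U c]. *)
have [h|h] := F2P ((a *m al) 0 0); rewrite h.
  rewrite scale0r addr0 /g /Dlift /= mulmxDl mulmxDr !tensmx_mul hP h /sg expr0 scale1r.
  by rewrite mul1mx mulmx1 comD comB.
rewrite scale1r /g /Dlift /= mulmxDl mulmxDr !tensmx_mul hP h /sg expr1 scaleN1r.
rewrite UD mul1mx mulmx1 -!mulmxA wD wB comD comB mulmxN; congr (_ + _).
by rewrite -scaleN1r tensmxZr -tensmxZl scaleN1r.
Qed.

(** Composing transvections adds their matrices, and [phi] is a sum of matrix units, each a column
    times a row as in the elementary case. *)
Lemma induced_transvection (phi : 'M['F_2]_(r, k)) :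
  induced Dlift (fun x => (x.1, x.2 + x.1 *m phi)).
Proof.
pose P (p : 'M['F_2]_(r, k)) := induced Dlift (fun x => (x.1, x.2 + x.1 *m p)).
have P0 : P 0.
  by apply: (induced_ext _ (induced_id Dlift)) => -[a b] /=; rewrite mulmx0 addr0.
have PD p1 p2 : P p1 -> P p2 -> P (p1 + p2).
  move=> h1 h2; apply: (induced_ext _ (induced_comp h1 h2)) => x /=.
  by rewrite mulmxDr addrA.
rewrite -/(P phi) [phi]matrix_sum_delta.
apply: (big_ind P P0 PD) => i _; apply: (big_ind P P0 PD) => j _.
have [->|->] := F2P (phi i j); first by rewrite scale0r; exact: P0.
rewrite scale1r.
by rewrite -(mul_delta_mx (0 : 'I_1)); exact: induced_elementary.
Qed.

(** The Kronecker product of a matrix inducing [tau] with the basis permutation attached to [M] acts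
    on both factors independently. *)
Lemma induced_tensor (M : 'M['F_2]_r) tau : M \in unitmx -> induced U tau ->
  induced Dlift (fun x => (x.1 *m M, tau x.2)).
Proof.
move=> uM [g [ug hg]]; have [Q uQ hQ] := exists_linear_perm K uM.
exists (g *t Q); split.
  by apply: tensmx_unit; rewrite -?lt0n ?expn_gt0.
move=> [a b]; case: (hg b) => c [c0 e]; exists c; split=> //.
by rewrite /Dlift /= !tensmx_mul hQ e tensmxZl.
Qed.

(* After correcting [g] by a translation, it commutes exactly with [D_r],
   hence is block diagonal and each of its blocks acts on [K^m]. *)
Lemma block_action g (f : 'rV['F_2]_k -> 'rV['F_2]_k) (c : V -> K) :
    g \in unitmx -> f 0 = 0 -> (forall x, c x != 0) ->
    (forall x, g *m Dlift x = c x *: (Dlift (x.1, f x.2) *m g)) ->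
  exists2 h : 'M[K]_m, h \in unitmx &
    forall b, h *m U b = c (0, b) *: (U (f b) *m h).
Proof.
move=> ug f0 c0 hg.
(* Lifts of elements of [D] are involutions, so the scalar at each generator of [D_r] is a sign.
   These signs form a vector [al], and translation by [al] cancels them. *)
have sgn i : exists x : 'F_2, c (delta_mx 0 i, 0) = sg K x.
  have := hg (delta_mx 0 i, 0); rewrite /= f0 => e.
  have one y : Dlift y *m Dlift y = 1 *: 1%:M by rewrite scale1r Dliftxx.
  have [->|->] := conj_scalar_sign dim_gt0 ug (oner_neq0 K) (one _) (one _) e.
    by exists 0; rewrite /sg expr0.
  by exists 1; rewrite /sg expr1.
have [al hal] := fin_all_exists sgn.
have [T [uT hT]] := exists_translation (\col_i al i).
pose h := T *m g; have uh : h \in unitmx by rewrite unitmx_mul uT.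
have hL x : h *m Dlift x = (c x * sg K ((x.1 *m (\col_i al i)) 0 0)) *: (Dlift (x.1, f x.2) *m h).
  by rewrite -mulmxA hg -scalemxAr mulmxA hT -scalemxAl scalerA mulmxA.
(* The coordinate characters separate the points of [F_2^r], hence the blocks. *)
have diagP (g' : 'M_(m * 2 ^ r)) :
    (forall i : 'I_r, g' *m Dlift (delta_mx 0 i, 0) = Dlift (delta_mx 0 i, 0) *m g') ->
  block_diagonal g'.
  move=> h'; apply: (@comm_diag_block_diagonal _ _ _ 'I_r
    (fun i => \row_j sg K (((delta_mx 0 i : 'rV_r) *m bitv j) 0 0))) => [j j' jj'|i].
    apply/existsP; apply: contraR jj'; rewrite negb_exists => /forallP eqj.
    apply/eqP/bitv_inj/matrixP => i l; rewrite (ord1 l).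
    by have /negPn := eqj i; rewrite ![(\row__ _) _ _]mxE !delta_mulmx => /eqP/sg_inj.
  by have := h' i; rewrite /Dlift mxpow0.
have hC i : h *m Dlift (delta_mx 0 i, 0) = Dlift (delta_mx 0 i, 0) *m h.
  by rewrite hL /= f0 delta_mulmx hal [(\col__ _) _ _]mxE sgxx scale1r.
have bh := diagP _ hC.
exists (block ord_first h).
  suff /mulmx1_unit[] : block ord_first h *m block ord_first (invmx h) = 1%:M by [].
  by rewrite -block_mul // mulmxV // block_one.
move=> b; rewrite -!block_Dlift -!block_mul //; last first.
  by apply: diagP => i; apply: Dlift_mulC.
(* The correcting translation adds no sign on [(0, b)], so the scalar is still [c (0, b)]. *)
by rewrite hL /= mul0mx mxE /sg expr0 mulr1 blockZ.
Qed.

Lemma centralizer_comm_U g (c : V -> K) :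
    g \in unitmx -> (forall x, c x != 0) ->
    (forall x, g *m Dlift x = c x *: (Dlift x *m g)) ->
  forall b, c (0, b) = 1.
Proof.
move=> ug c0 hg b.
have [||h uh hU] := @block_action g id c ug _ c0; first by [].
  by case.
have hv i : h *m v i = v i *m h.
  apply: v_rigid => // j; exists (c (0, delta_mx 0 j)); split=> //.
  by have := hU (delta_mx 0 j); rewrite mxpow_delta.
have : h *m U b = U b *m h.
  by apply: commr_prod => i _; apply: commrX; apply: hv.
rewrite hU -{2}[_ *m h]scale1r; apply: scalemx_inj => //.
have [uUb _] := mulmx1_unit (Uxx b).
by rewrite unitmx_mul uUb.
Qed.

(** Otherwise some translation [T] negates the lift of [f (0, b)]. Its conjugate by the inverse of
    [g] centralises [D] projectively yet negates the lift of [(0, b)], against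
    [centralizer_comm_U]. *)
Lemma induced_preserves_U f b : induced Dlift f -> (f (0, b)).1 = 0.
Proof.
move=> [g [ug hg]]; apply/eqP/negPn/negP => /exists_dual[al hal].
have [T [uT hT]] := exists_translation al.
pose h := invmx g *m T *m g.
have hL x : h *m Dlift x = sg K (((f x).1 *m al) 0 0) *: (Dlift x *m h).
  case: (hg x) => c [c0 e].
  have e' : Dlift (f x) = c^-1 *: (g *m Dlift x *m invmx g).
    by rewrite e -scalemxAl scalerA mulVf // scale1r mulmxK.
  rewrite /h -!mulmxA e -!scalemxAr [T *m _]mulmxA hT e' -!scalemxAl -!scalemxAr.
  rewrite !scalerA -!mulmxA mulKmx //; congr (_ *: _).
  by rewrite mulrAC mulfV // mul1r.
have uh : h \in unitmx by rewrite !unitmx_mul unitmx_inv ug uT.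
have := centralizer_comm_U uh (fun x => sg_neq0 K _) hL b.
by rewrite hal /sg expr1 => /eqP; rewrite eq_sym (negPf one_neqN1).
Qed.

Lemma induced_restrict f :
  induced Dlift (fun x : V => (x.1, f x.2)) -> induced U f.
Proof.
move=> indf; have f0 : f 0 = 0.
  have := induced_Dlift_additive indf 0 0; rewrite addr0 => -[_].
  by move/(congr1 (fun z => z - f 0)); rewrite /= addrK subrr.
case: indf => g [ug hg].
have [c hc] := fin_all_exists hg.
have [||h uh hU] := @block_action g f c ug f0.
- by move=> x; case: (hc x).
- by move=> x; case: (hc x).
by exists h; split=> // b; exists (c (0, b)); split=> //; case: (hc (0, b)).
Qed.

(** Additivity and stability of [U] make [f] block triangular; [M] and [tau] are its diagonal
    parts. *)
Lemma induced_perm_decompose (f : V -> V) : bijective f -> induced Dlift f ->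
  exists M phi tau, [/\ M \in unitmx, induced U tau &
    forall x, f x = (x.1 *m M, tau x.2 + x.1 *m M *m phi)].
Proof.
move=> [f' fK f'K] indf; have indf' := induced_inv f'K indf.
have fD := induced_Dlift_additive indf; have fU b := induced_preserves_U b indf.
have f'U b := induced_preserves_U b indf'.
have split_x (x : V) : x = (x.1, 0) + (0, x.2).
  by case: x => a b; congr (_, _); rewrite ?addr0 ?add0r.
have [|M hM] := @additive_mx _ _ (fun a => (f (a, 0)).1).
  move=> a a'; rewrite -[(f _).1 + _]/((f (a, 0) + f (a', 0)).1) -fD.
  by congr (f (_, _)).1; rewrite addr0.
have [|N hN] := @additive_mx _ _ (fun a => (f (a, 0)).2).
  move=> a a'; rewrite -[(f _).2 + _]/((f (a, 0) + f (a', 0)).2) -fD.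
  by congr (f (_, _)).2; rewrite addr0.
pose tau b := (f (0, b)).2.
have fE x : f x = (x.1 *m M, tau x.2 + x.1 *m N).
  rewrite [in LHS](split_x x) fD -hM -hN addrC.
  rewrite [f (0, _)]surjective_pairing fU [f (_, 0)]surjective_pairing.
  by congr (_, _); rewrite /= add0r.
(* The inverse of [f] preserves [U] too, so only [a = 0] can be sent into [U]. *)
have uM : M \in unitmx.
  rewrite -row_free_unit; apply: inj_row_free => a aM.
  have := f'U (f (a, 0)).2.
  have -> : (0, (f (a, 0)).2) = f (a, 0) by rewrite fE /= aM.
  by rewrite fK.
exists M, (invmx M *m N), tau; split=> //; last first.
  by move=> x; rewrite fE mulmxA mulmxK.
apply: induced_restrict.
(* The shear by [invmx M *m N] cancels the off-diagonal term in characteristic 2 and [invmx M] then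
   cancels [M], leaving [(a, tau b)]. *)
have h := induced_comp (induced_comp indf (induced_transvection (invmx M *m N)))
  (induced_tensor (tau := id) (etrans (unitmx_inv M) uM) (induced_id U)).
apply: (induced_ext _ h) => x /=; rewrite fE /= mulmxK // mulmxA mulmxK //.
by rewrite -addrA addF2xx addr0.
Qed.

End Automorphisms.

(** * The split extension inside the permutations of pairs of subsets *)

Section Assembly.
Variables q k : nat.
(** The successor form matches ['GL_r], whose matrices have size [r.-1.+1]. *)
Notation r := q.+1.
Notation X := ({set 'I_r} * {set 'I_k})%type.

Definition shear (phi : 'M['F_2]_(r, k)) (x : X) : X :=
  (x.1, setv (vset x.2 + vset x.1 *m phi)).

Lemma shear_inj phi : injective (shear phi).
Proof.
apply: inv_inj => -[S T]; rewrite /shear /= setvK -addrA addF2xx addr0 vsetK.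
by [].
Qed.

Definition shear_perm phi : {perm X} := perm (@shear_inj phi).

Lemma shear_permM : {in [set: 'M['F_2]_(r, k)] &,
  {morph shear_perm : x y / (x * y)%g >-> (x * y)%g}}.
Proof.
move=> phi psi _ _; apply/permP => x; rewrite permM !permE /shear /= setvK.
by rewrite FinRing.zmodMgE mulmxDr addrA.
Qed.

Canonical shear_morphism := Morphism shear_permM.

Definition levi (a : {'GL_r['F_2]} * {perm {set 'I_k}}) (x : X) : X :=
  (setv (vset x.1 *m GLval a.1), a.2 x.2).

Lemma levi_inj a : injective (levi a).
Proof.
move=> [S T] [S' T'] [] /(can_inj (@setvK _)) /(can_inj (mulmxK (GL_unitmx a.1))).
by move=> /(can_inj (@vsetK _)) -> /perm_inj ->.
Qed.

Definition levi_perm a : {perm X} := perm (@levi_inj a).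

Lemma levi_permM :
  {in [set: {'GL_r['F_2]} * {perm {set 'I_k}}] &,
    {morph levi_perm : x y / (x * y)%g >-> (x * y)%g}}.
Proof.
move=> a b _ _; apply/permP => x; rewrite permM !permE /levi /= setvK permM.
by rewrite mulmxA.
Qed.

Canonical levi_morphism := Morphism levi_permM.

Lemma vset_surj n (a : 'rV['F_2]_n) : exists S, vset S = a.
Proof. by exists (setv a); rewrite setvK. Qed.

Lemma eq_mul_row (p l : nat) (M N : 'M['F_2]_(p, l)) :
  (forall S : {set 'I_p}, vset S *m M = vset S *m N) -> M = N.
Proof.
move=> e; apply/row_matrixP => i; rewrite !rowE.
by case: (vset_surj (delta_mx 0 i)) => S <-.
Qed.

Lemma injm_shear : ('injm shear_morphism)%g.
Proof.
apply/injmP => phi psi _ _ e; apply: eq_mul_row => S.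
move/permP/(_ (S, set0)): e; rewrite !permE => -[] /(can_inj (@setvK _)).
by rewrite vset0 !add0r.
Qed.

Lemma injm_levi : ('injm levi_morphism)%g.
Proof.
apply/injmP => -[M s] [N t] _ _ e.
have {}e x : levi (M, s) x = levi (N, t) x by move/permP/(_ x): e; rewrite !permE.
congr (_, _).
  apply/val_inj/eq_mul_row => S.
  by case: (e (S, set0)) => /(can_inj (@setvK _)).
by apply/permP => T; case: (e (set0, T)).
Qed.

(** The kernel [E] is the group of shears, a copy of the additive group of [r] by [k] matrices.
    Linearity of the elements of [WU] is what makes the complement normalise it. *)
Lemma split_extension (W : {group {perm X}}) (WU : {group {perm {set 'I_k}}}) :
    (forall phi, shear_perm phi \in W) ->
    (forall M t, t \in WU -> levi_perm (M, t) \in W) ->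
    (forall s, s \in W -> exists M t phi,
       t \in WU /\ s = (levi_perm (M, t) * shear_perm phi)%g) ->
    (forall t, t \in WU -> exists B, forall T, vset (t T) = vset T *m B) ->
  exists E H : {group {perm X}},
    [/\ (E ><| H)%g = W, (2.-abelem E)%g, #|E| = (2 ^ (k * r))%N
      & (H \isog setX 'GL_r['F_2] WU)%g].
Proof.
move=> shearW leviW decW linWU.
pose E := [group of (shear_morphism @* [set: 'M['F_2]_(r, k)])%g].
pose H := [group of (levi_morphism @* setX 'GL_r['F_2] WU)%g].
have memE phi : shear_perm phi \in E by apply: mem_morphim; rewrite inE.
have memH M t : t \in WU -> levi_perm (M, t) \in H.
  by move=> tW; apply: mem_morphim; rewrite ?in_setX !inE.
have EP s : s \in E -> exists phi, s = shear_perm phi.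
  by case/morphimP => phi _ _ ->; exists phi.
have HP s : s \in H -> exists M t, t \in WU /\ s = levi_perm (M, t).
  by case/morphimP => -[M t] _; rewrite in_setX => /andP[_ tW] ->; exists M, t.
exists E, H; split.
- have nEH : H \subset 'N(E)%g.
    apply/subsetP => _ /HP[M [t [tW ->]]]; rewrite inE; apply/subsetP => s.
    case/imsetP => _ /EP[phi ->] ->; have [B hB] := linWU t tW.
    (* Here [B] is the matrix of [t] on [F_2^k]: conjugation changes basis on both sides of
       [phi]. *)
    have -> : (shear_perm phi ^ levi_perm (M, t))%g =
        shear_perm (invmx (GLval M) *m phi *m B).
      apply: (mulgI (levi_perm (M, t))); rewrite -conjgC.
      apply/permP => -[S T]; rewrite !permM !permE /levi /shear /=; congr (_, _).
      apply: (can_inj (@vsetK _)); rewrite hB !setvK hB mulmxDl !mulmxA.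
      by rewrite (mulmxK (GL_unitmx M)).
    exact: memE.
  rewrite sdprodE //.
    apply/eqP; rewrite eqEsubset; apply/andP; split.
      apply: mul_subG; apply/subsetP => s; first by case/EP => phi ->.
      by case/HP => M [t [tW ->]]; apply: leviW.
    rewrite -(normC nEH); apply/subsetP => s /decW[M [t [phi [tW ->]]]].
    by apply: mem_mulg; [apply: memH | apply: memE].
  apply/trivgP/subsetP => s; rewrite inE => /andP[/EP[phi ->] /HP[M [t [_ e]]]].
  rewrite inE; apply/eqP/permP => -[S T].
  have {}e x : shear phi x = levi (M, t) x by move/permP/(_ x): e; rewrite !permE.
  (* A shear fixes every [(set0, T)], so [t] fixes every [T]. At [(S, T)] the first coordinate is
     then fixed by the shear and the second by [t]. *)
  case: (e (set0, T)); rewrite vset0 !mul0mx addr0 vsetK => _ tT.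
  have := e (S, T); rewrite permE perm1 => h.
  by rewrite [shear _ _]surjective_pairing {2}h /= -tT.
- apply/abelemP => //; split; first by rewrite morphim_abelian // FinRing.zmod_abelian.
  move=> _ /EP[phi ->]; apply/permP => x; rewrite expgS expg1 permM perm1 !permE.
  by case: x => S T; rewrite /shear /= setvK -addrA addF2xx addr0 vsetK.
- by rewrite card_injm ?injm_shear // cardsT card_mx card_Fp // mulnC.
- by rewrite isog_sym; apply: sub_isog; [apply/subsetP => x; rewrite inE | apply: injm_levi].
Qed.

End Assembly.

(** * Replacing the given generators by involutions *)

Section WeylGroups.
Variables (K : closedFieldType) (m k : nat) (u : 'I_k -> 'M[K]_m).

Lemma involutive_lifts : eab_basis u -> exists v : 'I_k -> 'M[K]_m,
  forall i, pequiv (u i) (v i) /\ v i *m v i = 1%:M.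
Proof.
case=> _ u2 _ _.
suff lift i : exists w, pequiv (u i) w /\ w *m w = 1%:M.
  by have [v hv] := fin_all_exists lift; exists v.
case: (u2 i) => c [c0 e].
(* A square root [d] of the scalar [c], as a root of the monic polynomial [X^2 - c]; dividing by [d]
   normalises the square to 1. *)
have [d hd] := @solve_monicpoly K 2 (fun j => if j == 0 then c else 0) isT.
have {}hd : d ^+ 2 = c by rewrite hd !big_ord_recl big_ord0 /= expr0 mulr1 mul0r !addr0.
have d0 : d != 0 by rewrite -sqrf_eq0 hd.
exists (d^-1 *: u i); split.
  by exists d; rewrite scalerA mulfV ?scale1r.
by rewrite -scalemxAl -scalemxAr scalerA e scalerA -hd -invfM mulVf ?scale1r ?mulf_neq0.
Qed.

Variable v : 'I_k -> 'M[K]_m.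
Hypothesis uv : forall i, pequiv (u i) (v i).
Hypothesis vv : forall i, v i *m v i = 1%:M.
Hypothesis vC : forall i j, v i *m v j = v j *m v i.

Lemma eltU_mxpow S : pequiv (eltU u S) (mxpow v (vset S)).
Proof.
rewrite -(mxprod_hom S (mxpow0 v)) => [|a b]; last exact: mxpowD.
by apply: mxprod_pequiv => i; rewrite mxpow_delta.
Qed.

Lemma eltD_Dlift r (x : {set 'I_r} * {set 'I_k}) :
  pequiv (eltD u x) (Dlift v (vset x.1, vset x.2)).
Proof.
have -> : (vset x.1, vset x.2) = (vset x.1, 0) + (0, vset x.2).
  by congr (_, _); rewrite ?addr0 ?add0r.
rewrite DliftD //; apply: pequiv_mul.
  rewrite -(@mxprod_hom _ _ _ (fun a => Dlift v (a, 0))) => [||a b]; first 1 last.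
  - exact: Dlift0.
  - by rewrite -(DliftD vv vC) -[(a, 0) + _]/(a + b, 0 + 0); congr (Dlift v (_, _)); rewrite addr0.
  by apply: mxprod_pequiv => i; rewrite /Dlift mxpow0 Aw_delta; apply: pequiv_refl.
rewrite -(@mxprod_hom _ _ _ (fun b => Dlift v (0, b))) => [||a b]; first 1 last.
- exact: Dlift0.
- by rewrite -(DliftD vv vC) -[(0, a) + _]/(0 + 0, a + b); congr (Dlift v (_, _)); rewrite addr0.
apply: mxprod_pequiv => i; rewrite /Dlift mxpow_delta Aw0 /tensI.
by case: (uv i) => c [c0 ->]; exists c; rewrite tensmxZl.
Qed.

Lemma WeylU_E : WeylU u = inducedG (mxpow v \o @vset k).
Proof.
by apply/setP => s; rewrite !inE; apply/pboolP/pboolP => /(induced_equiv _ eltU_mxpow).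
Qed.

Lemma WeylD_E r : WeylD r u =
  inducedG (fun x : {set 'I_r} * {set 'I_k} => Dlift v (vset x.1, vset x.2)).
Proof.
by apply/setP => s; rewrite !inE; apply/pboolP/pboolP => /(induced_equiv _ (@eltD_Dlift r)).
Qed.

End WeylGroups.

(** * The structure of the Weyl group of [D] *)

Lemma WeylD_split (K : closedFieldType) (m r k : nat) (u : 'I_k -> 'M[K]_m) :
    (2 \notin [pchar K])%N -> (0 < m)%N -> (0 < r)%N -> eab_basis u ->
    (k = 0%N \/ (toral u /\ zariski_connected (PGL_centralizer_preim u))) ->
  exists E H : {group {perm ({set 'I_r} * {set 'I_k})}},
    [/\ (E ><| H)%g = WeylD r u,
        (2.-abelem E)%g,
        #|E| = (2 ^ (k * r))%N
      & (H \isog setX 'GL_r['F_2] (WeylU u))%g].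
Proof.
move=> char2 m_gt0 r_gt0 basis_u conn_u.
have two : 2%:R != 0 :> K by move: char2; rewrite inE.
have u_rigid g : PGL_centralizer_preim u g -> forall i, g *m u i = u i *m g.
  (* For [k = 0] there is no index [i]. *)
  case: conn_u => [k0|[_ conn]].
    by move=> _ i; have := ltn_ord i; rewrite {2}k0.
  exact: connected_centralizer_comm.
have [v hv] := involutive_lifts basis_u.
have uv i : pequiv (u i) (v i) by case: (hv i).
have vv i : v i *m v i = 1%:M by case: (hv i).
have vu i : pequiv (v i) (u i) by apply: pequiv_sym.
have comm_v g i : g *m u i = u i *m g -> g *m v i = v i *m g.
  by case: (vu i) => c [_ ->] e; rewrite -scalemxAr e -scalemxAl.
have v_rigid g : g \in unitmx -> (forall i, pconj g (v i) (v i)) ->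
    forall i, g *m v i = v i *m g.
  move=> ug hg i; apply/comm_v/u_rigid; split=> // j.
  by apply/pconjP => //; apply: (pconj_equiv (vu j) (vu j)).
have [u_unit _ u_comm v_free] := basis_u.
(* Each [v i] commutes projectively with the generators, hence lies in their projective centraliser,
   and rigidity upgrades this to exact commutation. *)
have vC i j : v i *m v j = v j *m v i.
  apply: v_rigid => [|l]; first by case: (mulmx1_unit (vv i)).
  apply: (pconj_equiv (uv l) (uv l)).
  case: (pequiv_mul (vu i) (pequiv_refl (u l))) => c [c0 ec].
  case: (pequiv_mul (pequiv_refl (u l)) (vu i)) => d [d0 ed].
  case: (u_comm i l) => e [e0 ee]; exists (c * e * d^-1).
  rewrite !mulf_neq0 ?invr_eq0 //; split=> //.
  by rewrite ec ee ed !scalerA divfK.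
have {}v_free b : pequiv (mxpow v b) 1%:M -> b = 0.
  rewrite -[b]setvK => h; rewrite (v_free (setv b)) ?vset0 //.
  by apply: pequiv_trans h; apply: eltU_mxpow.
rewrite (WeylU_E uv vv vC) (WeylD_E uv vv vC).
case: r r_gt0 {conn_u u_rigid} => // q _.
pose p (x : {set 'I_q.+1} * {set 'I_k}) := (vset x.1, vset x.2).
pose p' (x : 'rV['F_2]_q.+1 * 'rV['F_2]_k) := (setv x.1, setv x.2).
have pK : cancel p p' by case=> S T; rewrite /p' /= !vsetK.
have p'K : cancel p' p by case=> a b; rewrite /p /= !setvK.
pose W := Group (inducedG_group (Dlift v \o p)).
pose WU := Group (inducedG_group (mxpow v \o @vset k)).
have memW f (sigma : {perm _}) : induced (Dlift v) f -> sigma =1 p' \o f \o p -> sigma \in W.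
  move=> /(induced_transport _ _ pK p'K) indf e; rewrite inE; apply/pboolP.
  by apply: induced_ext indf => x; rewrite e.
have WP sigma : sigma \in W -> induced (Dlift v) (p \o sigma \o p').
  rewrite inE => /pboolP ind; apply/(induced_transport _ _ pK p'K).
  by apply: induced_ext ind => x /=; rewrite !pK.
have WUP tau : tau \in WU -> induced (mxpow v) (@vset k \o tau \o @setv k).
  rewrite inE => /pboolP ind; apply/(induced_transport _ _ (@vsetK k) (@setvK k)).
  by apply: induced_ext ind => x /=; rewrite !vsetK.
apply: (@split_extension q k W WU) => [phi|M t tW|sigma sW|tau tauW].
- apply: (memW _ _ (induced_transvection two vv vC phi)) => -[S T].
  by rewrite permE /shear /p' /= vsetK.
- apply: (memW _ _ (induced_tensor m_gt0 (GL_unitmx M) (WUP t tW))) => -[S T].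
  by rewrite permE /levi /p' /= !vsetK.
- have bij : bijective (p \o sigma \o p').
    by exists (p \o sigma^-1%g \o p') => x; rewrite /= pK ?permK ?permKV p'K.
  have [M [phi [tau [uM indt fE]]]] :=
    induced_perm_decompose two m_gt0 vv vC v_free v_rigid bij (WP _ sW).
  have sE S T : sigma (S, T) =
      p' (vset S *m M, tau (vset T) + vset S *m M *m phi).
    by rewrite -(fE (p (S, T))) /= !pK.
  (* Injectivity of [tau] is that of [sigma] on the pairs [(set0, T)]. *)
  have t_inj : injective (@setv k \o tau \o @vset k).
    move=> T T' /(can_inj (@setvK _)) e.
    suff [] : (set0, T) = (set0, T') :> {set 'I_q.+1} * {set 'I_k} by [].
    by apply: (@perm_inj _ sigma); rewrite !sE e.
  exists (FinRing.unit _ uM), (perm t_inj), phi; split.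
    rewrite inE; apply/pboolP.
    have := (induced_transport _ tau (@vsetK k) (@setvK k)).1 indt.
    by apply: induced_ext => x; rewrite permE.
  apply/permP => -[S T].
  by rewrite permM !permE sE /levi /shear /p' /= setvK [perm _ T]permE /= setvK.
have [|B hB] := @additive_mx _ _ (@vset k \o tau \o @setv k).
  exact: (induced_U_additive vv vC v_free (WUP _ tauW)).
by exists B => T; rewrite -hB /= vsetK.
Qed.

Theorem theorem4p14 (K : closedFieldType) (s t r k : nat)
    (u : 'I_k -> 'M[K]_(2 ^ (s - r) * t)) :
  (2 \notin [pchar K])%N -> odd t -> (0 < s)%N -> (0 < t)%N ->
  (1 <= r)%N -> (r <= s)%N ->
  eab_basis u ->
  (k = 0%N \/ (toral u /\ zariski_connected (PGL_centralizer_preim u))) ->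
  exists E H : {group {perm ({set 'I_r} * {set 'I_k})}},
    [/\ (E ><| H)%g = WeylD r u,
        (2.-abelem E)%g,
        #|E| = (2 ^ (k * r))%N
      & (H \isog setX 'GL_r['F_2] (WeylU u))%g].
Proof.
move=> char2 _ _ t_gt0 r_gt0 _; apply: WeylD_split => //.
by rewrite muln_gt0 expn_gt0.
Qed.
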